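(* Let $K$ be an infinite field, let $n > k \geq 1$ be integers, and let $A({\tt vdw}(n,k)) = K[x_1,\ldots,x_n]/(I_{{\tt vdw}(n,k)} + \langle x_1^2,\ldots,x_n^2\rangle)$. Then: (1) $A({\tt vdw}(n,1))$ has the SLP for all $n \geq 2$ if ${\rm char}(K) \neq 2$; (2) $A({\tt vdw}(n,2))$ has the WLP for all $n \geq 3$ if ${\rm char}(K) = 0$; (3) $A({\tt vdw}(n,n-1))$ has the SLP for all $n \geq 2$ if ${\rm char}(K) = 0$; (4) $A({\tt vdw}(n,k))$ has the WLP in degrees $0$ and $1$ for all $n > k$ if ${\rm char}(K) = 0$; and (5) $A({\tt vdw}(n,k))$ has the WLP in degree $k$ if $\frac{n}{2} \leq k < n$ and $k \geq 3$, if ${\rm char}(K) = 0$.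
   Context: For integers $n > k \geq 1$, the van der Waerden complex ${\tt vdw}(n,k)$ is the simplicial complex on the vertex set $\{x_1,\ldots,x_n\}$ whose facets are exactly the sets $\{x_i, x_{i+d}, x_{i+2d}, \ldots, x_{i+kd}\}$ with $i \geq 1$, $d \geq 1$ integers and $i+kd \leq n$ (arithmetic progressions with $k$ steps, i.e. $k+1$ elements, in $\{1,\ldots,n\}$). The Stanley-Reisner ideal $I_\Delta \subseteq K[x_1,\ldots,x_n]$ of a simplicial complex $\Delta$ on $\{x_1,\ldots,x_n\}$ is the ideal generated by the squarefree monomials $x_{i_1}\cdots x_{i_t}$ with $\{x_{i_1},\ldots,x_{i_t}\} \notin \Delta$. Let $A = \bigoplus_{i \geq 0} A_i$ be a standard graded Artinian quotient of $K[x_1,\ldots,x_n]$ by a homogeneous ideal. A linear map between finite-dimensional vector spaces has maximal rank if it is injective or surjective. $A$ has the Weak Lefschetz Property (WLP) in degree $j$ if, for a general linear form $\ell$ (i.e. for all $\ell$ in some nonempty Zariski-open subset of the space of linear forms), the multiplication map $\times \ell : A_j \to A_{j+1}$ has maximal rank. $A$ has the WLP if for a general linear form $\ell$ the map $\times\ell: A_i \to A_{i+1}$ has maximal rank for all $i \geq 0$. $A$ has the Strong Lefschetz Property (SLP) if for a general linear form $\ell$ the map $\times \ell^d : A_i \to A_{i+d}$ has maximal rank for all $i,d \geq 0$. *)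

(* Defs.v *)
From HB Require Import structures.
From mathcomp Require Import all_boot all_order all_algebra.
From mathcomp Require Import generic_quotient ring_quotient boolp.
From mathcomp Require Import mpoly.

Set Implicit Arguments.
Unset Strict Implicit.
Unset Printing Implicit Defensive.

Import GRing.Theory.

Local Open Scope ring_scope.
Local Open Scope quotient_scope.

(* The library's [idealr] demands 1 \notin S; the unit ideal is allowed here,
   so that the ideals below need no side condition to be formed, and the
   quotient ring may be trivial (hence [comPzRingType]). *)
Definition ideal_closed (R : comNzRingType) (S : {pred R}) : Prop :=
  0 \in S /\ forall a, {in S &, forall u v, a * u + v \in S}.

Record ideal (R : comNzRingType) := Ideal {
  ideal_mem : {pred R};
  ideal_memP : ideal_closed ideal_mem
}.

Section QuotientRing.
Variables (R : comNzRingType) (I : ideal R).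

Lemma ideal_zmod_closed : zmod_closed (ideal_mem I).
Proof.
have [I0 IM] := ideal_memP I; split=> // u v Iu Iv.
by rewrite addrC -mulN1r IM.
Qed.

HB.instance Definition _ :=
  GRing.isZmodClosed.Build R (ideal_mem I) ideal_zmod_closed.

Lemma ideal_memM a u : u \in ideal_mem I -> a * u \in ideal_mem I.
Proof.
by have [I0 IM] := ideal_memP I; move=> Iu; rewrite -[a * u]addr0 IM.
Qed.

Definition quot_ring : Type := Quotient.quot (ideal_mem I).

HB.instance Definition _ := Choice.on quot_ring.
HB.instance Definition _ := GRing.Zmodule.on quot_ring.

Definition quot_proj (p : R) : quot_ring :=
  \pi_(Quotient.quot (ideal_mem I)) p.

Definition quot_repr (a : quot_ring) : R :=
  repr (a : Quotient.quot (ideal_mem I)).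

Lemma quot_reprK : cancel quot_repr quot_proj.
Proof. exact: reprK. Qed.

Lemma quot_proj_eq p q : (quot_proj p == quot_proj q) = (p - q \in ideal_mem I).
Proof. by rewrite (Quotient.idealrBE (ideal_mem I)). Qed.

Lemma quot_proj_is_zmod_morphism : zmod_morphism quot_proj.
Proof.
by move=> p q; rewrite /quot_proj [LHS]Quotient.pi_add Quotient.pi_opp.
Qed.

HB.instance Definition _ :=
  GRing.isZmodMorphism.Build R quot_ring quot_proj quot_proj_is_zmod_morphism.

Definition quot_mul (a b : quot_ring) : quot_ring :=
  quot_proj (quot_repr a * quot_repr b).

Lemma quot_projM : {morph quot_proj : p q / p * q >-> quot_mul p q}.
Proof.
move=> p q; apply/eqP; rewrite quot_proj_eq.
set p' := quot_repr _; set q' := quot_repr _.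
have -> : p * q - p' * q' = q * (p - p') + p' * (q - q').
  by rewrite !mulrBr [q * p]mulrC [q * p']mulrC addrA subrK.
by rewrite rpredD // ideal_memM // -quot_proj_eq quot_reprK.
Qed.

Lemma quot_mulA : associative quot_mul.
Proof.
move=> a b c; rewrite -[a]quot_reprK -[b]quot_reprK -[c]quot_reprK.
by rewrite -!quot_projM mulrA.
Qed.

Lemma quot_mulC : commutative quot_mul.
Proof. by move=> a b; rewrite /quot_mul mulrC. Qed.

Lemma quot_mul1 : left_id (quot_proj 1) quot_mul.
Proof. by move=> a; rewrite -[a]quot_reprK -quot_projM mul1r. Qed.

Lemma quot_mulDl : left_distributive quot_mul +%R.
Proof.
move=> a b c; rewrite -[a]quot_reprK -[b]quot_reprK -[c]quot_reprK.
by rewrite -raddfD -!quot_projM mulrDl raddfD.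
Qed.

HB.instance Definition _ := GRing.Zmodule_isComPzRing.Build quot_ring
  quot_mulA quot_mulC quot_mul1 quot_mulDl.

Lemma quot_proj_is_monoid_morphism : monoid_morphism quot_proj.
Proof. by split=> //; exact: quot_projM. Qed.

HB.instance Definition _ := GRing.isMonoidMorphism.Build R quot_ring quot_proj
  quot_proj_is_monoid_morphism.

End QuotientRing.

Arguments quot_proj {R} I p.

Section IdealConstructions.
Variable R : comNzRingType.

Definition gen_mem (G : R -> Prop) : {pred R} := fun p =>
  `[< exists2 s : seq (R * R), (forall x, x \in s -> G x.2)
                             & p = \sum_(x <- s) x.1 * x.2 >].

Lemma gen_memP G : ideal_closed (gen_mem G).
Proof.
split; first by apply/asboolP; exists [::]; rewrite ?big_nil.
move=> a u v /asboolP[s Gs ->] /asboolP[t Gt ->]; apply/asboolP.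
exists ([seq (a * x.1, x.2) | x <- s] ++ t).
  by move=> x; rewrite mem_cat => /orP[/mapP[y /Gs ? ->]|/Gt].
rewrite big_cat big_map mulr_sumr; congr (_ + _).
by apply: eq_bigr => x _; rewrite mulrA.
Qed.

Definition ideal_gen (G : R -> Prop) : ideal R := Ideal (gen_memP G).

Definition add_mem (I J : ideal R) : {pred R} := fun p =>
  `[< exists u v, [/\ u \in ideal_mem I, v \in ideal_mem J & p = u + v] >].

Lemma add_memP I J : ideal_closed (add_mem I J).
Proof.
have [I0 IM] := ideal_memP I; have [J0 JM] := ideal_memP J.
split; first by apply/asboolP; exists 0, 0; rewrite addr0.
move=> a p q /asboolP[u [v [Iu Jv ->]]] /asboolP[u' [v' [Iu' Jv' ->]]].
apply/asboolP; exists (a * u + u'), (a * v + v').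
by split; rewrite ?IM ?JM // mulrDr addrACA.
Qed.

Definition ideal_add (I J : ideal R) : ideal R := Ideal (add_memP I J).

End IdealConstructions.

(* The vertex x_a, 1 <= a <= n, is encoded by the ordinal v : 'I_n with
   v.+1 = a. *)
Definition vdw_facet (n k : nat) (F : {set 'I_n}) : Prop :=
  exists i d : nat, [/\ (1 <= i)%N, (1 <= d)%N, (i + k * d <= n)%N
    & F = [set v : 'I_n | [exists j : 'I_k.+1, v.+1 == i + j * d]%N]].

Definition vdw (n k : nat) (s : {set 'I_n}) : Prop :=
  exists2 F, vdw_facet k F & s \subset F.
Arguments vdw n k s : clear implicits.

Section StanleyReisner.
Variables (K : fieldType) (n : nat).

Definition stanley_reisner_ideal (Delta : {set 'I_n} -> Prop) :
    ideal {mpoly K[n]} :=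
  ideal_gen (fun p => exists2 s : {set 'I_n},
    ~ Delta s & p = \prod_(i in s) 'X_i).

Definition squares_ideal : ideal {mpoly K[n]} :=
  ideal_gen (fun p => exists i : 'I_n, p = 'X_i ^+ 2).

End StanleyReisner.

(* The defining ideal of A(vdw(n,k)). *)
Definition vdw_ideal (K : fieldType) (n k : nat) : ideal {mpoly K[n]} :=
  ideal_add (stanley_reisner_ideal K (vdw n k)) (squares_ideal K n).

(* "For a general linear form": a linear form of K[x_1,...,x_n] is identified
   with its coefficient vector c, i.e. with a point of affine n-space. *)
Section GeneralLinearForm.
Variables (K : fieldType) (n : nat).

Definition linear_form (c : 'I_n -> K) : {mpoly K[n]} :=
  \sum_(i < n) c i *: 'X_i.

(* A Zariski-closed set is the common zero locus of a set S of polynomials. *)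
Definition zariski_open (U : ('I_n -> K) -> Prop) : Prop :=
  exists S : {mpoly K[n]} -> Prop,
    forall c, U c <-> ~ (forall f, S f -> f.@[c] = 0).

Definition general_linear_form (P : {mpoly K[n]} -> Prop) : Prop :=
  exists U : ('I_n -> K) -> Prop,
    [/\ zariski_open U, exists c, U c & forall c, U c -> P (linear_form c)].

End GeneralLinearForm.

(* Lefschetz properties of the standard graded algebra A = K[x_1,...,x_n]/I. *)
Section Lefschetz.
Variables (K : fieldType) (n : nat) (I : ideal {mpoly K[n]}).

Definition graded_piece (i : nat) (a : quot_ring I) : Prop :=
  exists2 p : {mpoly K[n]}, p \is i.-homog & a = quot_proj I p.

(* [x l ^ d : A_i -> A_(i+d)] is injective or surjective. *)
Definition mul_maximal_rank (l : {mpoly K[n]}) (d i : nat) : Prop :=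
  let f (a : quot_ring I) := quot_proj I l ^+ d * a in
  (forall a b, graded_piece i a -> graded_piece i b -> f a = f b -> a = b)
  \/ (forall b, graded_piece (i + d)%N b -> exists2 a, graded_piece i a & f a = b).

Definition WLP_in_degree (j : nat) : Prop :=
  general_linear_form (fun l => mul_maximal_rank l 1%N j).

Definition WLP : Prop :=
  general_linear_form (fun l => forall i, mul_maximal_rank l 1%N i).

Definition SLP : Prop :=
  general_linear_form (fun l => forall i d, mul_maximal_rank l d i).

End Lefschetz.

Definition infinite_field (K : fieldType) : Prop :=
  forall s : seq K, exists x : K, x \notin s.

Definition char0 (K : fieldType) : Prop := [pchar K] =i pred0.

(* Main.v *)
Require Import Defs.
From mathcomp Require Import all_boot all_order all_algebra.
From mathcomp Require Import boolp mpoly zify.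

(** For a simplicial complex D on n vertices, the algebra A(D) defined by the
Stanley-Reisner ideal and the squares of the variables has the squarefree
monomials x_s, for s a face of D, as a basis: a polynomial lies in the ideal
exactly when its coefficients on these monomials vanish ([ideal_face_coef],
[face_coef_ideal]).  Let l = sum_i c_i x_i with all c_i nonzero, which is a
nonempty open condition on c.  Rescaling the basis by the monomials in the c_i
turns multiplication by l into the operator [raise],
(raise g)(s) = sum_{v in s} g(s \ v), on functions on faces.  Maximal rank of
l^d : A_i -> A_(i+d) thus becomes a statement about d-fold sums of a function
on i-element faces ([maximal_rank_inj], [maximal_rank_onto]), and three
arguments cover all the cases.

Low degrees: 1 maps to l, which is nonzero, and to l^2, which is nonzero if 2
is invertible and there is an edge; A_1 -> A_2 is injective as soon as 2 is invertible and every vertex lies on a triangle of the 1-skeleton, since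
g(u) + g(v) = 0 on every edge of a triangle forces 2 g = 0
([raise_injective11]).  This applies to vdw(n,k) as soon as n >= 3; for n = 2
the map A_1 -> A_2 is onto, A_2 being spanned by the only monomial x_1 x_2.

Top degree, for k >= 2: A_k -> A_(k+1) is surjective ([vdw_raise_top]).  Take
a facet s, with step d, and remove its second element; the result still
contains both ends of s, so any other facet containing it has a step larger
than d.  Hence x_s is l times a monomial minus facets of larger step, and a
descending induction on the step concludes.

Full simplex, in characteristic 0: l^d : A_i -> A_(i+d) is injective if
2i + d <= n and surjective if 2i + d >= n ([raise_injective_boolean],
[raise_onto_boolean]).  Up to the factor d!, the image of g at a set s is the
sum of g over the i-subsets of s.  If these sums vanish when |s| = i + d, they
vanish for all larger s, in particular for the complement of any set with at
most i elements; inclusion-exclusion then isolates each value g(s).  Dually,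
the functions s |-> [a is contained in s] with |a| <= i lie in the image, and
inclusion-exclusion produces from them the indicator of each (i+d)-set. *)

Set Implicit Arguments.
Unset Strict Implicit.
Unset Printing Implicit Defensive.

Import GRing.Theory.

(** * Squarefree coefficients and the quotient algebra *)

Section SquarefreeCoefficients.
Local Open Scope ring_scope.
Variables (K : fieldType) (n : nat).
Implicit Types (p q : {mpoly K[n]}) (s t : {set 'I_n}) (c : 'I_n -> K).

Lemma mcoeffMX_notle p (m k : 'X_{1..n}) :
  ~~ (m <= k)%MM -> (p * 'X_[m])@_k = 0.
Proof.
move=> mk; apply/eqP; rewrite mcoeff_eq0 (perm_mem (msuppMX _ _)).
by apply/negP => /mapP[m' _ kE]; rewrite kE lem_addr in mk.
Qed.

(** [mesym1 s] is the exponent of the squarefree monomial with support [s]. *)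
Lemma mesym1_le s t : (mesym1 s <= mesym1 t)%MM = (s \subset t).
Proof.
apply/mnm_lepP/subsetP => [st i si|st i].
  by have := st i; rewrite !mnmE si; case: (i \in t).
by rewrite !mnmE; case si : (i \in s) => //; rewrite st.
Qed.

Lemma mesym1D1 s v : v \in s -> mesym1 s = (U_(v) + mesym1 (s :\ v))%MM.
Proof.
move=> sv; apply/mnmP => i; rewrite mnmDE mnm1E !mnmE !inE.
by case: (eqVneq i v) => [->|iv]; rewrite ?sv.
Qed.

Lemma mpolyX_mesym1 s : 'X_[K, mesym1 s] = \prod_(i in s) 'X_i.
Proof.
rewrite mprodXE; congr 'X_[_]; apply/mnmP => i; rewrite mnmE mnm_sumE.
case si : (i \in s).
  rewrite (bigD1 i) //= mnm1E eqxx big1 // => j /andP[_ /negbTE ji].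
  by rewrite mnm1E ji.
rewrite big1 // => j sj; rewrite mnm1E; case: eqP => // ji.
by rewrite -ji sj in si.
Qed.

(** [D] is the set of faces of a simplicial complex. *)
Variable D : {set 'I_n} -> Prop.
Hypothesis D_sub : forall s t, s \subset t -> D t -> D s.

Notation I := (ideal_add (stanley_reisner_ideal K D) (squares_ideal K n)).

Lemma ideal_face_coef p s : p \in ideal_mem I -> D s -> p@_(mesym1 s) = 0.
Proof.
move=> /asboolP[u [v [/asboolP[r1 Hr1 ->] /asboolP[r2 Hr2 ->] ->]]] Ds.
rewrite mcoeffD !raddf_sum /= !big_seq !big1 ?addr0 // => x xr.
- have [i ->] := Hr2 _ xr; rewrite mpolyXn mcoeffMX_notle //.
  apply/negP => /mnm_lepP /(_ i); rewrite mulmnE mnm1E eqxx mnmE.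
  by case: (i \in s).
- have [t Dt ->] := Hr1 _ xr; rewrite -mpolyX_mesym1 mcoeffMX_notle // mesym1_le.
  by apply/negP => ts; apply: Dt; apply: D_sub ts Ds.
Qed.

Lemma face_coef_ideal p :
  (forall s, D s -> p@_(mesym1 s) = 0) -> p \in ideal_mem I.
Proof.
move=> p0; rewrite [p]mpolyE.
apply: rpred_sum => m _; rewrite -mul_mpolyC.
have [/forallP sqm|] := boolP [forall i, m i <= 1]%N; last first.
  rewrite negb_forall => /existsP[i]; rewrite -ltnNge => mi.
  have mE : m = ((m - (U_(i) *+ 2)) + (U_(i) *+ 2))%MM.
    rewrite submK //; apply/mnm_lepP => j; rewrite mulmnE mnm1E.
    by case: eqP => [<-|]; rewrite ?mul1n ?mul0n.
  rewrite mE mpolyXD mulrA; apply/ideal_memM/asboolP.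
  exists 0, 'X_[U_(i) *+ 2]; rewrite add0r; split => //.
    exact: (ideal_memP _).1.
  apply/asboolP; exists [:: (1, 'X_[U_(i) *+ 2])].
    by move=> x; rewrite inE => /eqP -> /=; exists i; rewrite mpolyXn.
  by rewrite big_seq1 mul1r.
pose s := [set i | m i == 1]%N.
have ms : m = mesym1 s.
  apply/mnmP => i; rewrite mnmE inE.
  by have := sqm i; case: (m i) => [|[|]].
have [Ds|Ds] := pselect (D s).
  by rewrite ms p0 // mpolyC0 mul0r rpred0.
apply/ideal_memM/asboolP; exists 'X_[m], 0; rewrite addr0; split => //.
  apply/asboolP; exists [:: (1, 'X_[m])]; last by rewrite big_seq1 mul1r.
  by move=> x; rewrite inE => /eqP -> /=; exists s; rewrite // ms mpolyX_mesym1.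
exact: (ideal_memP _).1.
Qed.

(** Multiplication by a linear form with nonzero coefficients, written in the
rescaled basis of squarefree monomials. *)
Definition raise (g : {set 'I_n} -> K) (s : {set 'I_n}) : K :=
  \sum_(v in s) g (s :\ v).

(** The coordinate of [p] on the squarefree monomial with support [s], in the
basis rescaled so that all the coefficients of the linear form become 1. *)
Definition scaled_coef c p s : K := p@_(mesym1 s) / \prod_(i in s) c i.

Lemma mcoeff_linear_formM c p s :
  (linear_form c * p)@_(mesym1 s) = \sum_(v in s) c v * p@_(mesym1 (s :\ v)).
Proof.
rewrite mulr_suml raddf_sum [RHS]big_mkcond /=; apply: eq_bigr => v _.
rewrite -scalerAl mcoeffZ [_ * p]mulrC; case: ifP => [sv|/negbT sv].
  rewrite (mesym1D1 sv). by rewrite mcoeffMX.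
rewrite mcoeffMX_notle ?mulr0 //; apply/negP => /mnm_lepP /(_ v).
by rewrite mnm1E eqxx mnmE (negbTE sv).
Qed.

Lemma scaled_coef_linear_formM c p s : (forall i, c i != 0) ->
  scaled_coef c (linear_form c * p) s = raise (scaled_coef c p) s.
Proof.
move=> c0; rewrite /scaled_coef mcoeff_linear_formM /raise mulr_suml.
apply: eq_bigr => v sv; rewrite (big_setD1 v sv) /= invfM.
by rewrite [c v * _]mulrC mulrA mulfK // .
Qed.

Lemma eq_raise g g' : g =1 g' -> raise g =1 raise g'.
Proof. by move=> gg s; apply: eq_bigr. Qed.

Lemma eq_iter_raise d g g' : g =1 g' -> iter d raise g =1 iter d raise g'.
Proof. by move=> gg; elim: d => //= d; apply: eq_raise. Qed.

Lemma scaled_coef_expM c p d s : (forall i, c i != 0) ->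
  scaled_coef c (linear_form c ^+ d * p) s = iter d raise (scaled_coef c p) s.
Proof.
move=> c0; elim: d s => [|d IH] s; first by rewrite mul1r.
rewrite exprS -mulrA scaled_coef_linear_formM //=; exact: eq_raise.
Qed.

Lemma prod_set_neq0 c s : (forall i, c i != 0) -> \prod_(i in s) c i != 0.
Proof. by move=> c0; apply/prodf_neq0 => i _. Qed.

Lemma scaled_coef_homog c p i s :
  p \is i.-homog -> #|s| != i -> scaled_coef c p s = 0.
Proof.
move=> hp si; rewrite /scaled_coef (dhomog_nemf_coeff hp) ?mul0r //.
by rewrite /= mdeg_mesym1.
Qed.

(** The form of degree [i] whose scaled squarefree coefficients on the sets with
[i] elements are the values of [g]. *)
Definition squarefree_form c i (g : {set 'I_n} -> K) : {mpoly K[n]} :=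
  \sum_(s : {set 'I_n} | #|s| == i) (g s * \prod_(j in s) c j) *: 'X_[mesym1 s].

Lemma squarefree_form_homog c i g : squarefree_form c i g \is i.-homog.
Proof.
by apply: rpred_sum => s si; apply: rpredZ; rewrite dhomogX /= mdeg_mesym1.
Qed.

Lemma scaled_coef_form c i g s : (forall i, c i != 0) -> #|s| = i ->
  scaled_coef c (squarefree_form c i g) s = g s.
Proof.
move=> c0 si; rewrite /scaled_coef raddf_sum (bigD1 s) ?si //=.
rewrite [X in _ + X]big1 ?addr0 => [|t /andP[_ ts]]; rewrite mcoeffZ mcoeffX.
  by rewrite eqxx mulr1 mulfK ?prod_set_neq0.
by rewrite (inj_eq (@inj_mesym1 _)) (negbTE ts) mulr0.
Qed.

Lemma quot_eq_scaled_coef c p q i : (forall i, c i != 0) ->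
  p \is i.-homog -> q \is i.-homog ->
  quot_proj I p = quot_proj I q <->
  (forall s, D s -> #|s| = i -> scaled_coef c p s = scaled_coef c q s).
Proof.
move=> c0 hp hq; split=> [/eqP pq s Ds si|pq].
  congr (_ / _); apply/eqP; rewrite -subr_eq0 -mcoeffB.
  by rewrite (ideal_face_coef _ Ds) // -quot_proj_eq.
apply/eqP; rewrite quot_proj_eq; apply: face_coef_ideal => s Ds.
rewrite mcoeffB; apply/eqP; rewrite subr_eq0; apply/eqP.
have [si|si] := eqVneq #|s| i.
  by have /(mulIf (invr_neq0 (prod_set_neq0 s c0))) := pq s Ds si.
by rewrite !(dhomog_nemf_coeff _ (_ : mdeg (mesym1 s) != i)) ?mdeg_mesym1.
Qed.

(** Injectivity of the [d]-th power of a linear form on the part of degree [i]: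
[g] stands for its values on faces with [i] elements, the others are
irrelevant. *)
Definition raise_injective d i : Prop := forall g : {set 'I_n} -> K,
  (forall s, D s -> #|s| = (i + d)%N -> iter d raise g s = 0) ->
  forall s, D s -> #|s| = i -> g s = 0.

(** The function [h], read on the faces with [i + d] elements, lies in the image
of the [d]-th power of a linear form. *)
Definition raise_onto d i (h : {set 'I_n} -> K) : Prop :=
  exists g : {set 'I_n} -> K,
    forall s, D s -> #|s| = (i + d)%N -> iter d raise g s = h s.

Lemma linear_form_homog c : linear_form c \is 1.-homog.
Proof. by apply: rpred_sum => i _; apply: rpredZ; rewrite dhomogX /= mdeg1. Qed.

Lemma linear_form_exp_homog c p d i :
  p \is i.-homog -> linear_form c ^+ d * p \is (i + d).-homog.
Proof.
rewrite addnC => hp; apply: dhomogM => //.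
by have := dhomogMn d (linear_form_homog c); rewrite mul1n.
Qed.

Lemma iter_raise_local d i (g g' : {set 'I_n} -> K) s :
  (forall t, t \subset s -> #|t| = i -> g t = g' t) -> #|s| = (i + d)%N ->
  iter d raise g s = iter d raise g' s.
Proof.
elim: d s => [|d IH] s gg /=; rewrite ?addn0 ?addnS => si; first exact: gg.
apply: eq_bigr => v sv; apply: IH => [t ts|].
  by apply: gg; rewrite (subset_trans ts) ?subD1set.
by move: si; rewrite (cardsD1 v s) sv => -[].
Qed.

Lemma iter_raise_lin d a (g g' : {set 'I_n} -> K) s :
  iter d raise (fun t => a * g t + g' t) s =
  a * iter d raise g s + iter d raise g' s.
Proof.
elim: d s => //= d IH s; rewrite /raise mulr_sumr -big_split.
by apply: eq_bigr => v _; rewrite IH.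
Qed.

Lemma maximal_rank_inj c d i : (forall i, c i != 0) ->
  raise_injective d i -> mul_maximal_rank I (linear_form c) d i.
Proof.
move=> c0 inj; left => _ _ [p hp ->] [q hq ->].
have [lp lq] := (linear_form_exp_homog c d hp, linear_form_exp_homog c d hq).
rewrite -rmorphXn -!rmorphM => /(quot_eq_scaled_coef c0 lp lq) pq.
apply/(quot_eq_scaled_coef c0 hp hq) => s Ds si.
apply/eqP; rewrite -subr_eq0; apply/eqP; move: s Ds si.
apply: inj => s Ds si.
have -> : iter d raise (fun t => scaled_coef c p t - scaled_coef c q t) s =
    iter d raise (fun t => -1 * scaled_coef c q t + scaled_coef c p t) s.
  by apply: eq_iter_raise => t; rewrite mulN1r addrC.
rewrite iter_raise_lin mulN1r addrC.
by rewrite -!scaled_coef_expM // pq ?subrr.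
Qed.

Lemma maximal_rank_onto c d i : (forall i, c i != 0) ->
  (forall h, raise_onto d i h) ->
  mul_maximal_rank I (linear_form c) d i.
Proof.
move=> c0 onto; right => _ [q hq ->].
have [g gP] := onto (scaled_coef c q).
have hp := squarefree_form_homog c i g.
exists (quot_proj I (squarefree_form c i g)); first by exists (squarefree_form c i g).
rewrite -rmorphXn -rmorphM; 
have lp := linear_form_exp_homog c d hp.
apply/(quot_eq_scaled_coef c0 lp hq) => s Ds si.
rewrite scaled_coef_expM // -gP //.
by apply: iter_raise_local si => t _ ti; rewrite scaled_coef_form.
Qed.


(** * The image and the kernel in arbitrary complexes *)

Lemma eq_raise_onto d i (h h' : {set 'I_n} -> K) :
  (forall s, D s -> #|s| = (i + d)%N -> h s = h' s) ->
  raise_onto d i h -> raise_onto d i h'.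
Proof. by move=> hh [g gP]; exists g => s Ds si; rewrite -hh ?gP. Qed.

Lemma raise_onto_lin d i a (h h' : {set 'I_n} -> K) :
  raise_onto d i h -> raise_onto d i h' ->
  raise_onto d i (fun s => a * h s + h' s).
Proof.
move=> [g gP] [g' gP']; exists (fun s => a * g s + g' s) => s Ds si.
by rewrite iter_raise_lin gP ?gP'.
Qed.

Lemma raise_onto0 d i : raise_onto d i (fun=> 0).
Proof.
exists (fun=> 0) => s _ _; elim: d s => //= d IH s.
by rewrite /raise big1.
Qed.

Lemma raise_onto_sum d i (T : Type) (r : seq T) a (h : T -> {set 'I_n} -> K) :
  (forall x, raise_onto d i (h x)) ->
  raise_onto d i (fun s => \sum_(x <- r) a x * h x s).
Proof.
move=> hP; elim: r => [|x r IH].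
  by apply: eq_raise_onto (raise_onto0 d i) => s _ _; rewrite big_nil.
apply: eq_raise_onto (raise_onto_lin (a x) (hP x) IH) => s _ _.
by rewrite big_cons.
Qed.

Lemma raise_onto_basis d i :
  (forall s, D s -> #|s| = (i + d)%N -> raise_onto d i (fun t => (t == s)%:R)) ->
  forall h, raise_onto d i h.
Proof.
move=> bP h.
have {}bP s : raise_onto d i (fun t => (t == s)%:R).
  have [/bP{}bP|nDs] := pselect (D s); last first.
    apply: eq_raise_onto (raise_onto0 d i) => t Dt _.
    by case: eqP => // ts; rewrite -ts in nDs.
  have [/bP //|nsi] := eqVneq #|s| (i + d)%N.
  apply: eq_raise_onto (raise_onto0 d i) => t _ ti.
  by case: eqP => // ts; rewrite -ts ti eqxx in nsi.
apply: eq_raise_onto (raise_onto_sum (index_enum _) h bP) => s _ _.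
rewrite (bigD1 s) //= eqxx mulr1 big1 ?addr0 // => t /negbTE ts.
by rewrite eq_sym ts mulr0.
Qed.

Lemma raise_onto_empty d i :
  (forall s, D s -> #|s| <> (i + d)%N) -> forall h, raise_onto d i h.
Proof. by move=> e; apply: raise_onto_basis => s /e. Qed.

Lemma raise_injective_id i : raise_injective 0 i.
Proof. by move=> g g0 s Ds si; apply: g0 => //; rewrite addn0. Qed.

Lemma raise_set1 g v : raise g [set v] = g set0.
Proof. by rewrite /raise big_set1 setDv. Qed.

Lemma raise_set2 g u v : u != v -> raise g [set u; v] = g [set u] + g [set v].
Proof.
move=> uv; rewrite /raise big_setU1 ?inE //= big_set1 addrC.
have uvE : [set u; v] :\ u = [set v].
  by apply/setP => x; rewrite !inE; case: eqVneq => [->|//]; rewrite (negbTE uv).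
have vuE : [set u; v] :\ v = [set u].
  apply/setP => x; rewrite !inE orbC.
  by case: eqVneq => [->|//]; rewrite eq_sym (negbTE uv).
by rewrite uvE vuE.
Qed.

Lemma raise_injective01 v : D [set v] -> raise_injective 1 0.
Proof.
move=> Dv g g0 s _ /eqP; rewrite cards_eq0 => /eqP ->.
by rewrite -(raise_set1 g v); apply: g0; rewrite ?cards1.
Qed.

Lemma raise_injective02 u v : (2%:R != 0 :> K) ->
  u != v -> D [set u; v] -> raise_injective 2 0.
Proof.
move=> K2 uv Duv g g0 s _ /eqP; rewrite cards_eq0 => /eqP ->.
have := g0 _ Duv; rewrite cards2 uv /= => /(_ erefl).
rewrite raise_set2 // !raise_set1 -mulr2n -mulr_natl => /eqP.
by rewrite mulf_eq0 (negbTE K2) => /eqP.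
Qed.

Lemma raise_injective11 : (2%:R != 0 :> K) ->
  (forall v, exists u w,
     [/\ v != u, v != w & u != w] /\
     [/\ D [set v; u], D [set v; w] & D [set u; w]]) ->
  raise_injective 1 1.
Proof.
move=> K2 tri g g0 s _ /eqP/cards1P[v ->].
have [u [w [[vu vw uw] [Dvu Dvw Duw]]]] := tri v.
have pair x y : x != y -> D [set x; y] -> g [set x] = - g [set y].
  move=> xy Dxy; apply/eqP; rewrite -addr_eq0 -raise_set2 //; apply/eqP.
  by apply: g0 => //; rewrite cards2 xy.
have gvv : g [set v] = - g [set v].
  by rewrite {1}(pair v u) // (pair u w) // opprK -(pair w v) // 1?eq_sym // setUC.
apply/eqP; have /eqP := subrr (g [set v]); rewrite {2}gvv opprK -mulr2n -mulr_natl.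
by rewrite mulf_eq0 (negbTE K2).
Qed.

Lemma raise_delta (t s : {set 'I_n}) :
  raise (fun x => (x == t)%:R) s = ((t \subset s) && (#|s| == #|t|.+1))%:R :> K.
Proof.
rewrite /raise -natr_sum; congr _%:R.
have [/andP[ts /eqP st]|nts] := boolP (_ && _); last first.
  rewrite big1 // => v sv; case: eqP => // svt; case/negP: nts.
  by rewrite -svt subD1set (cardsD1 v s) sv /=.
have : #|s :\: t| == 1%N by rewrite cardsDS // st subSnn.
case/cards1P => v stv.
have /setP/(_ v) := stv; rewrite !inE eqxx => /andP[tv sv].
rewrite (bigD1 v) //= big1 ?addn0 => [|w /andP[sw wv]].
  have -> : s :\ v = t; last by rewrite eqxx.
  apply/setP => x; rewrite !inE; have /setP/(_ x) := stv; rewrite !inE.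
  have := subsetP ts x; case: (x \in t) => [/(_ isT) ->|_];
    by case: (x == v); case: (x \in s).
case: eqP => // swt; have /setP/(_ w) := stv; rewrite !inE sw (negbTE wv).
by rewrite -swt !inE eqxx.
Qed.

(** Since raising the indicator of [s :\ v] gives the sum of the indicators of
the faces that cover it, one of these lies in the image if all the others
do. *)
Lemma raise_onto_facet i s v : #|s| = i.+1 -> v \in s ->
  (forall s', D s' -> #|s'| = i.+1 -> s :\ v \subset s' -> s' != s ->
     raise_onto 1 i (fun t => (t == s')%:R)) ->
  raise_onto 1 i (fun t => (t == s)%:R).
Proof.
move=> si sv others.
have ti : #|s :\ v| = i by move: si; rewrite (cardsD1 v s) sv => -[].
pose P s' := [&& s :\ v \subset s', #|s'| == i.+1 & s' != s].
have sumP : raise_onto 1 i (fun t => \sum_s' - (P s')%:R * (t == s')%:R).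
  pose h s' t : K := (P s')%:R * (t == s')%:R.
  have hP s' : raise_onto 1 i (h s').
    have [/and3P[vs' /eqP s'i s's]|nP] := boolP (P s'); last first.
      by apply: eq_raise_onto (raise_onto0 _ _) => t _ _; rewrite /h (negbTE nP) mul0r.
    have [Ds'|nDs'] := pselect (D s').
      apply: eq_raise_onto (others _ Ds' s'i vs' s's) => t _ _.
      by rewrite /h /P vs' s'i eqxx s's mul1r.
    apply: eq_raise_onto (raise_onto0 _ _) => t Dt _; rewrite /h.
    by case: eqP => [ts|_]; rewrite ?mulr0 // -ts in nDs' *.
  apply: eq_raise_onto (raise_onto_sum (index_enum _) (fun=> -1) hP) => t _ _.
  by apply: eq_bigr => s' _; rewrite /h mulrA mulN1r.
have ontov : raise_onto 1 i (fun t => (s :\ v \subset t)%:R).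
  exists (fun x => (x == s :\ v)%:R) => t _; rewrite addn1 => tci.
  by rewrite /= raise_delta ti tci eqxx andbT.
apply: eq_raise_onto (raise_onto_lin 1 ontov sumP) => t _; rewrite addn1 => tci.
rewrite mul1r (bigD1 t) //= big1 => [|s' s't]; last first.
  by rewrite eq_sym (negbTE s't) mulr0.
rewrite eqxx mulr1 addr0 /P tci eqxx /=; case: eqVneq => [->|_].
  by rewrite subD1set andbF oppr0 addr0.
by rewrite andbT subrr.
Qed.

Lemma raise_onto_last i : n = i.+1 -> forall h, raise_onto 1 i h.
Proof.
move=> ni; apply: raise_onto_basis => s _; rewrite addn1 => si.
have full (x : {set 'I_n}) : #|x| = i.+1 -> x = setT.
  by move=> xi; apply/eqP; rewrite eqEcard subsetT cardsT card_ord xi ni /=.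
have /card_gt0P[v sv] : (0 < #|s|)%N by rewrite si.
apply: (raise_onto_facet si sv) => s' _ /full -> _.
by rewrite (full s si) eqxx.
Qed.

(** * The full simplex in characteristic zero *)

Section Boolean.
Hypothesis K0 : char0 K.

Lemma char0_natr_neq0 m : (0 < m)%N -> m%:R != 0 :> K.
Proof. by move=> m0; rewrite ((pcharf0P K).1 K0) -lt0n. Qed.

(** Each [i]-subset of [s] survives the removal of the [#|s| - i] elements of [s]
that it does not contain. *)
Lemma raise_sum_sub (g : {set 'I_n} -> K) i s :
  raise (fun t => \sum_(x : {set 'I_n} | (x \subset t) && (#|x| == i)) g x) s =
  (#|s| - i)%:R * \sum_(x : {set 'I_n} | (x \subset s) && (#|x| == i)) g x.
Proof.
pose P (x : {set 'I_n}) := (x \subset s) && (#|x| == i).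
rewrite /raise /= (exchange_big_dep P) /=; last first.
  by move=> v x _ /andP[xs xi]; rewrite /P xi (subset_trans xs) ?subD1set.
rewrite mulr_sumr; apply: eq_bigr => x /andP[xs /eqP xi].
rewrite (eq_bigl (mem (s :\: x))) => [|v]; last first.
  by rewrite !inE xi eqxx andbT subsetD1 xs andTb andbC.
by rewrite sumr_const cardsDS // xi mulr_natl.
Qed.

Lemma iter_raise_sum_sub (g : {set 'I_n} -> K) d i s : #|s| = (i + d)%N ->
  iter d raise g s =
  d`!%:R * \sum_(x : {set 'I_n} | (x \subset s) && (#|x| == i)) g x.
Proof.
elim: d s => [|d IH] s; rewrite ?addn0 ?addnS => si /=.
  rewrite mul1r (bigD1 s) ?si ?subxx ?eqxx //= big1 ?addr0 //.
  move=> x /andP[/andP[xs xi]]; rewrite eqEcard xs.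
  by rewrite (eqP xi) si leqnn.
rewrite /raise (eq_bigr (fun v => d`!%:R *
  \sum_(x : {set 'I_n} | (x \subset s :\ v) && (#|x| == i)) g x)); last first.
  by move=> v sv; apply: IH; move: si; rewrite (cardsD1 v s) sv => -[].
rewrite -mulr_sumr; have := raise_sum_sub g i s; rewrite /raise /= => ->.
rewrite si subSn ?leq_addr // addKn.
by rewrite mulrA -natrM mulnC factS.
Qed.

Lemma raise_injective_boolean d i : (forall s, D s) -> (i + (i + d) <= n)%N ->
  raise_injective d i.
Proof.
move=> Dall idn g g0 s0 _ s0i.
(* The sums over the i-subsets of s vanish for all s with at least i + d
   elements. *)
have big_sub m s : #|s| = (i + d + m)%N ->
    \sum_(x : {set 'I_n} | (x \subset s) && (#|x| == i)) g x = 0.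
  elim: m s => [|m IH] s si.
    rewrite addn0 in si; have /eqP := g0 s (Dall s) si.
    rewrite (iter_raise_sum_sub g si) mulf_eq0.
    by rewrite (negbTE (char0_natr_neq0 (fact_gt0 d))) => /eqP.
  have /eqP := raise_sum_sub g i s; rewrite /raise big1 => [|v sv]; last first.
    by apply: IH; move: si; rewrite addnS (cardsD1 v s) sv => -[].
  rewrite eq_sym mulf_eq0 (negbTE (char0_natr_neq0 _)) => [/eqP //|].
  by rewrite si subn_gt0 -addnA !addnS ltnS leq_addr.
(* Inclusion-exclusion, one element of a at a time, on the sum of g over the
   i-sets that contain a and avoid b. *)
have avoid m (a b : {set 'I_n}) : #|a| = m -> (#|a| + #|b| <= i)%N ->
    \sum_(x : {set 'I_n} | [&& #|x| == i, a \subset x & x \subset ~: b]) g x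
      = 0.
  elim: m a b => [|m IH] a b am abi.
    move/eqP: am; rewrite cards_eq0 => /eqP a0; rewrite a0 cards0 add0n in abi.
    rewrite -[RHS](big_sub (#|~: b| - (i + d))%N (~: b)); last first.
      rewrite subnKC // -(leq_add2l #|b|) cardsC card_ord.
      by apply: leq_trans idn; rewrite leq_add2r.
    by apply: eq_bigl => x; rewrite a0 sub0set andbC.
  have /card_gt0P[v av] : (0 < #|a|)%N by rewrite am.
  have am' : #|a :\ v| = m by move: am; rewrite (cardsD1 v a) av => -[].
  have abi' : (#|a :\ v| + #|v |: b| <= i)%N.
    rewrite am'; apply: leq_trans abi; rewrite am addSnnS leq_add2l.
    by rewrite cardsU1; case: (_ \notin _).
  have := IH _ _ am' abi'.
  have : \sum_(x : {set 'I_n} |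
      [&& #|x| == i, a :\ v \subset x & x \subset ~: b]) g x = 0.
    by apply: IH => //; apply: leq_trans abi; rewrite leq_add2r am am'.
  rewrite (bigID (fun x : {set 'I_n} => v \in x)) /= => sum0 sum1.
  move: sum0; rewrite [X in _ + X](_ : _ = 0) ?addr0 => [sum0|]; last first.
    rewrite -[RHS]sum1; apply: eq_bigl => x.
    by rewrite setCU subsetI [X in [&& _, _, X & _]]subsetC sub1set inE -!andbA;
      do !bool_congr.
  rewrite -[RHS]sum0; apply: eq_bigl => x.
  rewrite -[in LHS](setD1K av) subUset sub1set.
  by case: (v \in x); rewrite ?andbF ?andbT ?andTb.
have := avoid i s0 set0 s0i; rewrite s0i cards0 addn0 leqnn => /(_ isT).
rewrite setC0 (bigD1 s0) ?s0i ?eqxx ?subxx ?subsetT //= big1 ?addr0 // => x.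
case/andP=> /and3P[/eqP xi s0x _]; case/negP.
by rewrite eq_sym eqEcard s0x xi s0i leqnn.
Qed.

Lemma iter_raise_superset (a s : {set 'I_n}) d :
  iter d raise (fun t => (a \subset t)%:R) s =
  ((#|s| - #|a|) ^_ d)%:R * (a \subset s)%:R :> K.
Proof.
elim: d s => [|d IH] s /=; first by rewrite mul1r.
have [as_|nas] := boolP (a \subset s); last first.
  rewrite mulr0 /raise big1 // => v _; rewrite IH.
  case: (boolP (a \subset s :\ v)) => [asv|_]; last by rewrite mulr0.
  by rewrite (subset_trans asv) ?subD1set in nas.
rewrite mulr1 /raise (eq_bigr (fun v =>
    if v \notin a then ((#|s| - #|a|).-1 ^_ d)%:R else 0)) => [|v sv]; last first.
  rewrite IH subsetD1 as_; case: (v \in a); rewrite ?mulr0 // mulr1.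
  by rewrite (cardsD1 v s) sv add1n -subn1 -subnDA addn1 subSS.
rewrite -big_mkcondr /= (eq_bigl (mem (s :\: a))) => [|v]; last first.
  by rewrite !inE andbC.
by rewrite sumr_const cardsDS // -mulrnA ffactnS mulnC.
Qed.

Lemma raise_onto_boolean d i : (n <= i + (i + d))%N ->
  forall h, raise_onto d i h.
Proof.
move=> idn; apply: raise_onto_basis => s0 _ s0i.
(* Inclusion-exclusion, one element of b at a time, on the indicator of the
   sets that contain a and avoid b. *)
have avoid m (a b : {set 'I_n}) : #|b| = m -> (#|a| + #|b| <= i)%N ->
    raise_onto d i (fun s => ((a \subset s) && (s \subset ~: b))%:R).
  elim: m a b => [|m IH] a b bm abi.
    move/eqP: bm; rewrite cards_eq0 => /eqP b0; rewrite b0 cards0 addn0 in abi *.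
    have onto_a : raise_onto d i
        (fun s => ((#|s| - #|a|) ^_ d)%:R * (a \subset s)%:R).
      by exists (fun s => (a \subset s)%:R) => s _ _; rewrite iter_raise_superset.
    pose e : K := ((i + d - #|a|) ^_ d)%:R^-1.
    apply: eq_raise_onto (raise_onto_lin e onto_a (raise_onto0 d i)) => s _ si.
    rewrite si setC0 subsetT andbT mulrA mulVf ?mul1r ?addr0 //.
    by rewrite char0_natr_neq0 // ffact_gt0 addnC -addnBA ?leq_addr.
  have /card_gt0P[v bv] : (0 < #|b|)%N by rewrite bm.
  have bm' : #|b :\ v| = m by move: bm; rewrite (cardsD1 v b) bv => -[].
  have on1 : raise_onto d i (fun s => ((a \subset s) && (s \subset ~: (b :\ v)))%:R).
    by apply: IH => //; apply: leq_trans abi; rewrite leq_add2l bm bm'.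
  have on2 : raise_onto d i (fun s => ((v |: a \subset s) && (s \subset ~: (b :\ v)))%:R).
    apply: IH => //; apply: leq_trans abi; rewrite bm bm' addnS -addSn leq_add2r.
    by rewrite cardsU1; case: (_ \notin _).
  apply: eq_raise_onto (raise_onto_lin (-1) on2 on1) => s _ _.
  rewrite -[in RHS](setD1K bv) setCU subsetI [X in _ && (X && _)]subsetC sub1set inE.
  rewrite subUset sub1set; case: (v \in s); case: (a \subset s);
    case: (s \subset _); by rewrite /= ?mulr0 ?add0r ?mulr1 ?addNr.
(* Among the (i + d)-sets, only s0 avoids the complement of s0. *)
apply: eq_raise_onto (avoid _ set0 (~: s0) erefl _) => [s _ si|].
  by rewrite sub0set setCK eqEcard s0i si leqnn andbT.
rewrite cards0 add0n -(leq_add2l #|s0|) cardsC card_ord s0i.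
by apply: leq_trans idn _; rewrite addnC.
Qed.

End Boolean.
End SquarefreeCoefficients.

(** * Van der Waerden complexes *)

Section VanDerWaerden.
Implicit Types n k : nat.
Local Open Scope ring_scope.

(** The linear forms with nonzero coefficients form a nonempty open set: the
complement of the zero locus of the product of the variables. *)
Lemma general_linear_formW (K : fieldType) n (P : {mpoly K[n]} -> Prop) :
  (forall c, (forall i, c i != 0) -> P (linear_form c)) -> general_linear_form P.
Proof.
move=> cP; exists (fun c => forall i, c i != 0); split => //.
  exists (fun f => f = \prod_i 'X_i) => c; split=> [c0 /(_ _ erefl)/eqP|nz i].
    by apply/negP; rewrite rmorph_prod /=; apply/prodf_neq0 => i _; rewrite mevalXU.
  apply/negP => /eqP ci; apply: nz => _ ->.
  by rewrite rmorph_prod /= (bigD1 i) //= mevalXU ci mul0r.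
by exists (fun=> 1) => i; rewrite oner_neq0.
Qed.

Lemma vdw_sub n k (s t : {set 'I_n}) : s \subset t -> vdw n k t -> vdw n k s.
Proof. by move=> st [F fF tF]; exists F => //; apply: subset_trans tF. Qed.

Lemma vdw_facet_card n k (F : {set 'I_n}) : vdw_facet k F -> (#|F| <= k.+1)%N.
Proof.
move=> [a [d [_ _ _ ->]]].
pose f (j : 'I_k.+1) : option 'I_n := insub (a + j * d).-1.
have := leq_imset_card f [set: 'I_k.+1]; rewrite cardsT card_ord; apply: leq_trans.
rewrite -(card_imset _ (@Some_inj _)).
apply: subset_leq_card; apply/subsetP => _ /imsetP[v + ->].
rewrite inE => /existsP[j /eqP vj]; apply/imsetP; exists j => //.
by rewrite /f -vj valK.
Qed.

Lemma vdw_card n k (s : {set 'I_n}) : vdw n k s -> (#|s| <= k.+1)%N.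
Proof.
by move=> [F /vdw_facet_card Fk /subset_leq_card sF]; apply: leq_trans Fk.
Qed.

(** The facets of step 1 are the sets of [k + 1] consecutive vertices. *)
Lemma vdw_interval n k a (s : {set 'I_n}) : (1 <= a)%N -> (a + k <= n)%N ->
  (forall v : 'I_n, v \in s -> a <= v.+1 <= a + k)%N -> vdw n k s.
Proof.
move=> a1 akn sa.
exists [set v : 'I_n | [exists j : 'I_k.+1, v.+1 == a + j * 1]%N].
  by exists a, 1%N; rewrite muln1.
apply/subsetP => v /sa /andP[av vak]; rewrite inE; apply/existsP.
have vk : (v.+1 - a < k.+1)%N by rewrite ltnS leq_subLR.
by exists (Ordinal vk); rewrite /= muln1 subnKC.
Qed.

Lemma vdw_full n (s : {set 'I_n}) : (0 < n)%N -> vdw n (n - 1) s.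
Proof.
move=> n0; apply: (@vdw_interval n (n - 1) 1) => [//||v _]; first by rewrite subnKC.
by rewrite subnKC // ltn_ord.
Qed.

Lemma vdw1_pair n (u v : 'I_n) : u != v -> vdw n 1 [set u; v].
Proof.
wlog uv : u v / (u < v)%N => [W|_].
  move=> nuv; have := nuv; rewrite -val_eqE neq_ltn => /orP[] /W.
    exact.
  by rewrite setUC eq_sym; apply.
exists [set w : 'I_n | [exists j : 'I_2, w.+1 == u.+1 + j * (v - u)]%N].
  exists u.+1, (v - u)%N; split=> //; first by rewrite subn_gt0.
  by rewrite mul1n addSn subnKC // ltnW.
apply/subsetP => w; rewrite !inE => /orP[] /eqP ->; apply/existsP.
  by exists ord0; rewrite addn0.
by exists ord_max; rewrite /= mul1n addSn subnKC // ltnW.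
Qed.

Lemma vdw_triangle n k (v : 'I_n) : (1 <= k < n)%N -> (3 <= n)%N ->
  exists u w : 'I_n, [/\ v != u, v != w & u != w] /\
     [/\ vdw n k [set v; u], vdw n k [set v; w] & vdw n k [set u; w]].
Proof.
move=> /andP[k1 kn] n3.
(* The triangle consists of three consecutive vertices t, t + 1, t + 2. *)
pose t := minn v (n - 3).
have [u [w [[vu vw uw] [ut wt]]]] : exists u w : 'I_n,
    [/\ v != u, v != w & u != w] /\ (t <= u <= t + 2 /\ t <= w <= t + 2)%N.
  have vn := ltn_ord v; rewrite /t.
  have others x y : (x < n)%N -> (y < n)%N ->
      v != x :> nat -> v != y :> nat -> x != y ->
      (t <= x <= t + 2 -> t <= y <= t + 2 -> exists u w : 'I_n,
      [/\ v != u, v != w & u != w] /\ (t <= u <= t + 2 /\ t <= w <= t + 2))%N.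
    move=> xn yn vx vy xy xt yt.
    by exists (Ordinal xn), (Ordinal yn); rewrite -!val_eqE.
  have [vt|vt|vt] := ltngtP (v : nat) (n - 2)%N.
  - by apply: (others v.+1 v.+2); rewrite /t; lia.
  - by apply: (others (n - 3)%N (n - 2)%N); rewrite /t; lia.
  - by apply: (others (n - 3)%N (n - 1)%N); rewrite /t; lia.
exists u, w; split=> //.
have [k_eq1|k2] : k = 1%N \/ (2 <= k)%N by lia.
  by rewrite k_eq1; split; apply: vdw1_pair.
have vt : (t <= v <= t + 2)%N by have := ltn_ord v; rewrite /t; lia.
pose a := minn t.+1 (n - k).
have near (x y : 'I_n) : (t <= x <= t + 2)%N -> (t <= y <= t + 2)%N ->
    vdw n k [set x; y].
  move=> xt yt; apply: (@vdw_interval n k a) => [||z].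
  - by rewrite /a; lia.
  - by rewrite /a; lia.
  - rewrite !inE => /orP[] /eqP -> {z}; have := ltn_ord v; rewrite /a /t in xt yt *; lia.
by split; apply: near.
Qed.

Variable K : fieldType.

(** This holds over any field. *)
Lemma vdw_raise_top n k : (2 <= k)%N -> forall h,
  raise_onto (K := K) (vdw n k) 1 k h.
Proof.
move=> k2; apply: raise_onto_basis => s Ds; rewrite addn1 => sk.
have facetE x : vdw n k x -> #|x| = k.+1 -> exists a d : nat,
    [/\ (1 <= a)%N, (1 <= d)%N, (a + k * d <= n)%N
      & x = [set v : 'I_n | [exists j : 'I_k.+1, v.+1 == a + j * d]%N]].
  move=> [F FF xF] xk; have [a [d [a1 d1 adn FE]]] := FF; exists a, d; split=> //.
  by rewrite -FE; apply/eqP; rewrite eqEcard xF xk vdw_facet_card.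
suff onto m a d : (1 <= a)%N -> (1 <= d)%N -> (a + k * d <= n)%N -> (n <= d + m)%N ->
    let x := [set v : 'I_n | [exists j : 'I_k.+1, v.+1 == a + j * d]%N] in
    #|x| = k.+1 -> raise_onto (K := K) (vdw n k) 1 k (fun t => (t == x)%:R).
  have [a [d [a1 d1 adn sE]]] := facetE _ Ds sk.
  by have := onto n a d a1 d1 adn (leq_addl _ _); rewrite /= -sE => /(_ sk).
(* Induction on m, which bounds n - d, for the progression of step d. *)
elim: m a d => [|m IH] a d a1 d1 adn ndm x xk; first by nia.
(* In zero-based numbering, the second element of the progression. *)
have second_n : (a + d.-1 < n)%N by nia.
pose v := Ordinal second_n.
apply: (raise_onto_facet (v := v)) => //.
  have k1 : (1 < k.+1)%N by lia.
  by rewrite inE; apply/existsP; exists (Ordinal k1); apply/eqP => /=; lia.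
move=> s' Ds' s'k vs' s'x; have [a' [d' [a1' d1' adn' s'E]]] := facetE _ Ds' s'k.
have first_n : (a.-1 < n)%N by nia.
have last_n : (a.-1 + k * d < n)%N by nia.
have : Ordinal first_n \in s'.
  apply: (subsetP vs'); rewrite !inE -val_eqE /=; apply/andP; split; first by lia.
  by apply/existsP; exists ord0; apply/eqP => /=; lia.
have : Ordinal last_n \in s'.
  apply: (subsetP vs'); rewrite !inE -val_eqE /=; apply/andP; split; first by nia.
  by apply/existsP; exists ord_max; apply/eqP => /=; lia.
rewrite {1 2}s'E !inE => /existsP[q /eqP /= qE] /existsP[p /eqP /= pE].
have qk : (q <= k)%N by rewrite -ltnS.
(* Both ends of x lie in s', at positions p < q, so d' >= d, with equality only
   if p = 0 and q = k. *)
have kd : (k * d = (q - p) * d')%N by nia.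
have [dd'|d'd] := ltnP d d'.
  rewrite s'E; apply: IH => //; first by lia.
  by rewrite -s'E.
case/eqP: s'x; have [dE aE] : d' = d /\ a' = a by nia.
by rewrite s'E dE aE.
Qed.

End VanDerWaerden.

Theorem theorem1p1 (K : fieldType) (K_infinite : infinite_field K) :
  (2 \notin [pchar K]%R ->
     forall n : nat, 2 <= n -> SLP (vdw_ideal K n 1)) /\
  (char0 K ->
     forall n : nat, 3 <= n -> WLP (vdw_ideal K n 2)) /\
  (char0 K ->
     forall n : nat, 2 <= n -> SLP (vdw_ideal K n (n - 1))) /\
  (char0 K ->
     forall n k : nat, 1 <= k < n ->
       WLP_in_degree (vdw_ideal K n k) 0 /\ WLP_in_degree (vdw_ideal K n k) 1) /\
  (char0 K ->
     forall n k : nat, n <= 2 * k -> k < n -> 3 <= k ->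
       WLP_in_degree (vdw_ideal K n k) k).
Proof.
have two_neq0 : 2 \notin [pchar K]%R -> (2%:R != 0 :> K)%R by rewrite inE /=.
have char0_2 : char0 K -> (2%:R != 0 :> K)%R.
  by move=> K0; apply: two_neq0; rewrite K0.
have inj n k c d i : (forall j : 'I_n, c j != 0%R) ->
    raise_injective K (vdw n k) d i ->
    mul_maximal_rank (vdw_ideal K n k) (linear_form c) d i.
  by move=> c0; apply: maximal_rank_inj c0; apply: vdw_sub.
have onto n k c d i : (forall j : 'I_n, c j != 0%R) ->
    (forall h, raise_onto (K := K) (vdw n k) d i h) ->
    mul_maximal_rank (vdw_ideal K n k) (linear_form c) d i.
  by move=> c0; apply: maximal_rank_onto c0; apply: vdw_sub.
have high n k d i h : k.+1 < i + d -> raise_onto (K := K) (vdw n k) d i h.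
  move=> kid; apply: raise_onto_empty => s /vdw_card sk si.
  by rewrite si leqNgt kid in sk.
have inj01 n k : 1 <= k < n -> raise_injective K (vdw n k) 1 0.
  case/andP=> k1 kn; have n0 : 0 < n by apply: leq_ltn_trans kn.
  apply: (@raise_injective01 _ _ _ (Ordinal n0)).
  apply: (@vdw_interval n k 1) => // v; rewrite inE => /eqP -> /=.
  by rewrite leq_addr.
have inj11 n k : 2%:R%R != 0%R :> K -> 1 <= k < n -> 3 <= n ->
    raise_injective K (vdw n k) 1 1.
  by move=> K2 kn n3; apply: raise_injective11 => // v; apply: vdw_triangle.
have slp1 : (2 \notin [pchar K])%R -> forall n, 2 <= n -> SLP (vdw_ideal K n 1).
  move=> /two_neq0 K2 n n2; apply: general_linear_formW => c c0 i d.
  have [id3|id2] := leqP 3 (i + d); first by apply: onto => // h; apply: high.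
  case: d id2 => [_|[|[|d]]]; rewrite ?addn1 ?addn2; last by rewrite !addnS.
  - by apply: inj => //; apply: raise_injective_id.
  - case: i => [_|[_|//]]; first exact/inj/inj01.
    have [n3|n3] := leqP 3 n; first exact/inj/inj11.
    by apply: onto => //; apply: raise_onto_last; lia.
  - case: i => // _; apply: inj => //.
    have n0 : 0 < n by apply: ltnW.
    apply: (@raise_injective02 _ _ _ (Ordinal n0) (Ordinal n2)) => //.
    exact: vdw1_pair.
split; first exact: slp1.
split.
  move=> /char0_2 K2 n n3; apply: general_linear_formW => c c0 [|[|[|i]]].
  - exact/inj/inj01.
  - exact/inj/inj11.
  - by apply: onto => //; apply: vdw_raise_top.
  - by apply: onto => // h; apply: high; rewrite addn1.
have slpn : char0 K -> forall n, 2 <= n -> SLP (vdw_ideal K n (n - 1)).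
  move=> K0 n n2; apply: general_linear_formW => c c0 i d.
  have [idn|/ltnW idn] := leqP (i + (i + d)) n.
    apply: inj => //; apply: raise_injective_boolean => // s.
    exact/vdw_full/ltnW.
  by apply: onto => //; apply: raise_onto_boolean.
split=> //; split.
  move=> K0 n k kn; split; apply: general_linear_formW => c c0.
    exact/inj/inj01.
  have [n3|n3] := leqP 3 n; first exact/inj/inj11/n3/kn/char0_2.
  by apply: onto => //; apply: raise_onto_last; lia.
move=> K0 n k _ _ k3; apply: general_linear_formW => c c0.
by apply: onto => //; apply/vdw_raise_top/ltnW.
Qed.
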